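(* For every integer $n\ge1$, the ascent generating polynomial of Motzkin sequences $\mathrm{asc}_{\mathcal{MP}(n)}(t)=\sum_{\mathbf w\in\mathcal{MP}(n)}t^{\mathrm{asc}(\mathbf w)}$ satisfies $$\mathrm{asc}_{\mathcal{MP}(n)}(t)=\sum_{i=0}^{\lfloor (n-1)/2\rfloor}\binom{n-1}{2i}C_i\,t^i={}_2F_1\!\left(\frac{1-n}{2},\frac{2-n}{2};2;4t\right),$$ where $C_i=\frac1{i+1}\binom{2i}{i}$ is the $i$th Catalan number.
   Context: $\mathcal{MP}(n)$ is the set of Motzkin sequences of size $n$: sequences $\mathbf w=(w_1,\dots,w_n)$ of positive integers with $w_1=w_n=1$ and $|w_i-w_{i+1}|\le1$ for $1\le i<n$. $\mathrm{asc}(\mathbf w)$ is the number of indices $i\in\{1,\dots,n-1\}$ with $w_i<w_{i+1}$. ${}_2F_1$ is the ordinary hypergeometric function (here a terminating series). *)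

(* Defs.v *)
From HB Require Import structures.
From mathcomp Require Import all_boot all_order all_algebra.
From mathcomp Require Import zify.
From mathcomp Require Import all_classical all_reals all_analysis.

Set Implicit Arguments.
Unset Strict Implicit.
Unset Printing Implicit Defensive.

Import Order.TTheory GRing.Theory Num.Theory.
Import numFieldNormedType.Exports.

Local Open Scope classical_set_scope.
Local Open Scope ring_scope.

(* The entry w_i (1 <= i <= n) of a sequence is [nth 0%N w i.-1]. *)
Definition motzkin_seqs (n : nat) : set (n.-tuple nat) :=
  [set w | [/\ forall i : nat, (i < n)%N -> (0 < nth 0%N w i)%N,
               nth 0%N w 0 = 1%N,
               nth 0%N w n.-1 = 1%N
             & forall i : nat, (i.+1 < n)%N ->
                 (`|(nth 0%N w i)%:Z - (nth 0%N w i.+1)%:Z| <= 1)%R ]].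
Arguments motzkin_seqs n : clear implicits.

Definition asc (n : nat) (w : n.-tuple nat) : nat :=
  #|[pred i : 'I_n.-1 | (nth 0%N w i < nth 0%N w i.+1)%N]|.

(* Sums over a classical set are only meaningful for finite support. *)
Lemma finite_motzkin_seqs (n : nat) : finite_set (motzkin_seqs n).
Proof.
pose f (u : n.-tuple 'I_n.+2) : n.-tuple nat := map_tuple val u.
have fimg : finite_set (f @` setT) by exact/finite_image/finite_finset.
apply: sub_finite_set fimg.
move=> w [_ w0 _ wd] /=.
have wb i : (i < n)%N -> (nth 0 w i <= i.+1)%N.
  elim: i => [|i IH] hi; first by rewrite w0.
  have := IH (ltnW hi); have := wd i hi; lia.
exists (map_tuple inord w) => //.
apply: eq_from_tnth => i; rewrite !tnth_map /= inordK //.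
rewrite (tnth_nth 0%N); have hi := ltn_ord i; have := wb i hi; lia.
Qed.

Definition asc_poly (K : numFieldType) (n : nat) : {poly K} :=
  \sum_(w \in motzkin_seqs n) ('X^(asc w) : {poly K}).

Definition catalan (K : numFieldType) (i : nat) : K :=
  (i.+1)%:R^-1 * 'C(2 * i, i)%:R.

Definition pochhammer (K : numFieldType) (a : K) (k : nat) : K :=
  \prod_(i < k) (a + i%:R).

(* Sum of the Gauss series wherever it converges, in particular (for every z)
   when it terminates, i.e. when a or b is a nonpositive integer. *)
Definition hyp2F1 (K : numFieldType) (a b c z : K) : K :=
  limn (series (fun k : nat =>
    pochhammer a k * pochhammer b k / pochhammer c k * (z ^+ k / k`!%:R))).

(* Main.v *)
(* Cut a Motzkin sequence after its first entry: the generating polynomials of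
   walks of length m from height h to the bottom satisfy a three-term
   recurrence, solved by the coefficients 'C(m, 2 i + h) B(i, h), where m - 2i - h
   is the number of level steps and B(i, h) the ballot number counting walks with
   i up-steps and i + h down-steps.  The hypergeometric form follows from
   4^k (-m/2)_k ((1-m)/2)_k = m (m-1) ... (m-2k+1). *)
Require Import Defs.
From mathcomp Require Import all_boot all_order all_algebra.
From mathcomp Require Import zify ring.
From mathcomp Require Import all_classical all_reals all_analysis.

Set Implicit Arguments.
Unset Strict Implicit.
Unset Printing Implicit Defensive.

Import Order.TTheory GRing.Theory Num.Theory.
Import numFieldNormedType.Exports.
Local Open Scope ring_scope.

Definition motzkin_step (a b : nat) : bool :=
  [&& (0 < b)%N, (a <= b.+1)%N & (b <= a.+1)%N].

Definition neighbours (a : nat) : seq nat :=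
  [seq b <- [:: a.+1; a; a.-1] | (0 < b)%N].

(* The starting entry a is not listed. *)
Fixpoint walks (m a : nat) : seq (seq nat) :=
  if m is k.+1 then [seq b :: s | b <- neighbours a, s <- walks k b]
  else if a == 1%N then [:: [::]] else [::].

Definition seq_asc (a : nat) (s : seq nat) : nat := count id (pairmap ltn a s).

Lemma walksS (m a : nat) :
  walks m.+1 a = [seq b :: s | b <- neighbours a, s <- walks m b].
Proof. by []. Qed.

Lemma mem_neighbours (a b : nat) : (0 < a)%N -> (b \in neighbours a) = motzkin_step a b.
Proof. by move=> a0; rewrite mem_filter !inE /motzkin_step; lia. Qed.

Lemma uniq_neighbours (a : nat) : (0 < a)%N -> uniq (neighbours a).
Proof. by move=> a0; rewrite filter_uniq //= !inE; lia. Qed.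

(** Ties the recursive enumeration, which suits generating polynomials, to the [path] predicate,
    which [pathP] turns into the indexwise Motzkin conditions. *)
Lemma mem_walks (m a : nat) (s : seq nat) : (0 < a)%N ->
  (s \in walks m a) = [&& size s == m, path motzkin_step a s & last a s == 1%N].
Proof.
elim: m a s => [|m IHm] a s a0.
  by rewrite /=; case: eqP => [->|/eqP/negbTE a1]; case: s => [|b s] //=; rewrite ?a1.
rewrite walksS; apply/allpairsPdep/idP => [[b [s' [hb hs' ->]]]|].
  move: hb; rewrite mem_neighbours // => hb.
  by move: hs'; rewrite IHm /= ?eqSS ?hb //; case/and3P: hb.
case: s => [|b s] //=; rewrite eqSS => /and3P[sz /andP[hb hp] hl].
exists b, s; split=> //; first by rewrite mem_neighbours.
by rewrite IHm ?sz ?hp //; case/and3P: hb.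
Qed.

Lemma walks_uniq (m a : nat) : (0 < a)%N -> uniq (walks m a).
Proof.
elim: m a => [|m IHm] a a0; first by rewrite /=; case: eqP.
rewrite walksS; apply: allpairs_uniq_dep; first exact: uniq_neighbours.
  by move=> b; rewrite mem_filter => /andP[b0 _]; apply: IHm.
by move=> [b s] [b' s'] _ _ /= [-> ->].
Qed.

Lemma asc_seq_asc (n : nat) (w : n.+1.-tuple nat) :
  asc w = seq_asc (head 0%N w) (behead w).
Proof.
case: w => [[|a s] //= sz]; rewrite /asc /= /seq_asc -sum1_card big_mkcond /=.
have {sz} : size s = n by apply: succn_inj; apply/eqP.
elim: s a n => [|b s IHs] a n /= <-; first by rewrite big_ord0.
by rewrite big_ord_recl /= -(IHs b _ erefl) inE /=; congr (_ + _)%N; case: ltnP.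
Qed.

Lemma motzkin_seqsE (m : nat) (w : m.+1.-tuple nat) :
  motzkin_seqs m.+1 w <-> (w : seq nat) \in [seq 1%N :: s | s <- walks m 1].
Proof.
case: w => [[|a s] //= sz0]; have sz : size s = m by apply: succn_inj; apply/eqP.
have nth_m : nth 0%N (a :: s) m = last a s by rewrite (last_nth 0%N) sz.
split=> [[/= pos a1 hm hd]|/mapP[s' hs' [ea es]]].
  subst a; apply: map_f; rewrite mem_walks // sz -nth_m hm !eqxx /= andbT.
  apply/(pathP 0%N) => i; rewrite sz => hi.
  by have := hd i hi; have := pos i.+1 hi; rewrite /motzkin_step /=; lia.
subst a; move: hs'; rewrite -es mem_walks // sz eqxx /=.
move=> /andP[/(pathP 0%N) hp /eqP hl]; rewrite sz in hp.
split=> /= [[|i] hi|||i hi] //; first by have /and3P[] := hp i hi.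
- by rewrite nth_m.
- by have /and3P[_] := hp i hi; rewrite /=; lia.
Qed.

(** Equals [(h+1)/(i+h+1) * 'C(2i+h, i)]; the quotient is taken in [K], so the recurrences below are
    field identities. *)
Definition ballot (K : numFieldType) (i h : nat) : K :=
  (h.+1 * (2 * i + h)`!)%:R / (i`! * (i + h).+1`!)%:R.

Lemma fact_neq0 (K : numFieldType) (n : nat) : n`!%:R != 0 :> K.
Proof. by rewrite pnatr_eq0 -lt0n fact_gt0. Qed.

Lemma ballot0 (K : numFieldType) (h : nat) : ballot K 0 h = 1.
Proof. by rewrite /ballot muln0 !add0n fact0 mul1n factS divff // -factS fact_neq0. Qed.

(** Split by the first step from height [h+1]: going up uses one of the [i+1] up-steps, going down
    uses none. *)
Lemma ballotSS (K : numFieldType) (i h : nat) :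
  ballot K i.+1 h.+1 = ballot K i h.+2 + ballot K i.+1 h.
Proof.
rewrite /ballot.
have -> : (2 * i.+1 + h.+1 = (2 * i + h).+3)%N by lia.
have -> : (2 * i + h.+2 = (2 * i + h).+2)%N by lia.
have -> : (2 * i.+1 + h = (2 * i + h).+2)%N by lia.
rewrite !addSn !addnS [(_.+3)`!]factS [(_.+3)`!]factS [i.+1`!]factS.
have := fact_neq0 K i; have := fact_neq0 K (i + h).+2.
(* Every factorial is now a multiple of one of these three, so they can be opaque atoms for
   [field]. *)
move: i`! (i + h).+2`! (2 * i + h).+2`! => a b c b0 a0.
rewrite !natrM; field.
by rewrite a0 b0 -?natrD ?nat1r !pnatr_eq0.
Qed.

(** From the bottom the first step can only go up. *)
Lemma ballotS0 (K : numFieldType) (i : nat) : ballot K i.+1 0 = ballot K i 1.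
Proof.
rewrite /ballot.
have -> : (2 * i.+1 + 0 = (2 * i).+2)%N by lia.
rewrite addn0 !addn1 [(_.+2)`!]factS [i.+1`!]factS.
have := fact_neq0 K i; have := fact_neq0 K i.+2.
move: i`! i.+2`! (2 * i).+1`! => a b c b0 a0.
rewrite !natrM; field.
by rewrite a0 b0 ?nat1r !pnatr_eq0.
Qed.

Lemma catalan_ballot (K : numFieldType) (i : nat) : catalan K i = ballot K i 0.
Proof.
rewrite /catalan /ballot mul1n !addn0 factS.
have hi : (i <= 2 * i)%N by lia.
rewrite -(bin_fact hi); have -> : (2 * i - i = i)%N by lia.
have := fact_neq0 K i; move: i`! 'C(2 * i, i) => a b a0.
rewrite !natrM; field.
by rewrite a0 nat1r pnatr_eq0.
Qed.

Definition walk_poly (K : numFieldType) (m a : nat) : {poly K} :=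
  \sum_(s <- walks m a) 'X^(seq_asc a s).

(** The summands are the up, level and down first steps; only the first is an ascent. At [h = 0] the
    down step would reach the entry 0, which [neighbours] filters out. *)
Lemma walk_polyS (K : numFieldType) (m h : nat) :
  walk_poly K m.+1 h.+1 = 'X * walk_poly K m h.+2 + walk_poly K m h.+1
                          + (if h is k.+1 then walk_poly K m k.+1 else 0).
Proof.
have step b : \sum_(s <- walks m b) 'X^(seq_asc h.+1 (b :: s))
    = 'X^(h.+1 < b)%N * walk_poly K m b.
  rewrite /walk_poly big_distrr /=; apply: eq_bigr => s _.
  by rewrite -exprD.
rewrite {1}/walk_poly walksS big_allpairs_dep /neighbours /=.
case: h step => [|h] step; rewrite !big_cons big_nil /= !step ltnSn ltnn.
  by rewrite expr1 expr0 mul1r !addr0.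
by rewrite ltnNge leqnSn /= expr1 expr0 !mul1r !addr0 addrA.
Qed.

(* The entry h + 1 is at height h above the bottom entry 1. *)
Lemma coef_walk_poly (K : numFieldType) (m h i : nat) :
  (walk_poly K m h.+1)`_i = 'C(m, 2 * i + h)%:R * ballot K i h.
Proof.
elim: m h i => [|m IHm] h i.
  rewrite /walk_poly /=; case: h => [|h]; rewrite ?big_seq1 ?big_nil ?coef0 /=.
    rewrite /seq_asc /= expr0 coef1; case: i => [|i]; first by rewrite ballot0 mulr1.
    by rewrite bin_small ?mul0r //; lia.
  by rewrite bin_small ?mul0r //; lia.
rewrite walk_polyS !coefD coefXM !IHm.
(* Pascal's rule splits the target binomial: one part is the level step; up and down steps share the
   other, and their ballot numbers add up by the ballot recurrence. *)
case: i => [|i] /=; rewrite ?add0r ?IHm; case: h => [|h]; rewrite ?coef0 ?IHm.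
- by rewrite !muln0 !addn0 !bin0 addr0.
- by rewrite !muln0 !add0n !ballot0 !mulr1 -natrD -binS.
- have -> : (2 * i.+1 + 0 = (2 * i + 1).+1)%N by lia.
  by rewrite binS natrD ballotS0 addr0 mulrDl addrC.
- have -> : (2 * i.+1 + h.+1 = (2 * i + h.+2).+1)%N by lia.
  have -> : (2 * i.+1 + h = 2 * i + h.+2)%N by lia.
  by rewrite binS natrD ballotSS; ring.
Qed.

Lemma asc_poly_walk (K : numFieldType) (m : nat) :
  asc_poly K m.+1 = walk_poly K m 1.
Proof.
pose r : seq (seq nat) := [seq 1%N :: s | s <- walks m 1].
(* All lists in [r] have length [m+1], so [insub] discards none; duplicate-freeness then turns the
   sum over the set into a sum over a list. *)
pose rt : seq (m.+1.-tuple nat) := pmap insub r.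
have ur : uniq rt.
  by apply: pmap_sub_uniq; rewrite map_inj_uniq ?walks_uniq // => ? ? [].
have -> : asc_poly K m.+1 = \sum_(w <- rt) 'X^(asc w).
  rewrite fsbig_seq // /asc_poly; suff -> : motzkin_seqs m.+1 = [set` rt]%classic by [].
  by apply/seteqP; split=> w /=; rewrite mem_pmap_sub => /motzkin_seqsE.
rewrite big_pmap big_map; apply: eq_big_seq => s.
rewrite mem_walks // => /and3P[/eqP sz _ _].
have sz1 : size (1%N :: s) == m.+1 by rewrite /= sz.
by rewrite insubT /= asc_seq_asc.
Qed.

Lemma natr_ffactS (R : pzRingType) (m j : nat) :
  (m ^_ j.+1)%:R = (m ^_ j)%:R * (m%:R - j%:R) :> R.
Proof.
rewrite ffactnSr natrM; have [jm|mj] := leqP j m; first by rewrite natrB.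
by rewrite ffact_small // !mul0r.
Qed.

(** The [k]-th factors satisfy [4(-m/2+k)((1-m)/2+k) = (m-2k)(m-2k-1)], the next two factors of the
    falling factorial. *)
Lemma pochhammer_half_mul (K : numFieldType) (m k : nat) :
  pochhammer (- m%:R / 2) k * pochhammer ((1 - m%:R) / 2) k * 4 ^+ k
  = (m ^_ (2 * k))%:R :> K.
Proof.
elim: k => [|k IHk]; first by rewrite /pochhammer !big_ord0 expr0 !mulr1.
have -> : (2 * k.+1 = (2 * k).+2)%N by lia.
rewrite !natr_ffactS -IHk /pochhammer !big_ord_recr /= exprS.
rewrite -[(2 * k).+1%:R]natr1 natrM.
by field.
Qed.

Lemma pochhammer2 (K : numFieldType) (k : nat) : pochhammer 2 k = (k.+1)`!%:R :> K.
Proof.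
elim: k => [|k IHk]; first by rewrite /pochhammer big_ord0.
by rewrite /pochhammer big_ord_recr /= -/(pochhammer 2 k) IHk -natrD -natrM factS mulnC.
Qed.

(** The partial sums are constant from index [N] on, so the limit is that constant. *)
Lemma hyp2F1_finite (K : numFieldType) (a b c z : K) (N : nat) :
  (forall k, (N <= k)%N -> pochhammer a k * pochhammer b k = 0) ->
  hyp2F1 a b c z = \sum_(0 <= k < N)
    pochhammer a k * pochhammer b k / pochhammer c k * (z ^+ k / k`!%:R).
Proof.
move=> h0; apply: norm_lim_near_cst; exists N => // k /= Nk.
rewrite /series /= (big_cat_nat _ Nk) //= -[RHS]addr0; congr (_ + _).
by rewrite big_nat big1 // => i /andP[Ni _]; rewrite h0 // !mul0r.
Qed.

Theorem theorem6p10 (K : numFieldType) (n : nat) (hn : (1 <= n)%N) :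
  asc_poly K n =
    \sum_(0 <= i < (n.-1 %/ 2).+1) ('C(n.-1, 2 * i)%:R * catalan K i) *: 'X^i
  /\ forall t : K,
       (\sum_(0 <= i < (n.-1 %/ 2).+1)
          ('C(n.-1, 2 * i)%:R * catalan K i) *: 'X^i).[t] =
         hyp2F1 ((1 - n%:R) / 2) ((2 - n%:R) / 2) 2 (4 * t).
Proof.
case: n hn => // m _ /=; split.
  rewrite asc_poly_walk; apply/polyP => i.
  rewrite coef_walk_poly addn0 big_mkord.
  rewrite -(poly_def _ (fun k => 'C(m, 2 * k)%:R * catalan K k)) coef_poly catalan_ballot.
  case: ltnP => // hi; rewrite bin_small ?mul0r //.
  have := ltn_ceil m (ltn0Sn 1); lia.
move=> t.
have -> : (1 - m.+1%:R) / 2 = - m%:R / 2 :> K by rewrite -natr1; ring.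
have -> : (2 - m.+1%:R) / 2 = (1 - m%:R) / 2 :> K by rewrite -natr1; ring.
have four0 : 4 != 0 :> K by rewrite pnatr_eq0.
have pm k : pochhammer (- m%:R / 2) k * pochhammer ((1 - m%:R) / 2) k
    = (m ^_ (2 * k))%:R / 4 ^+ k :> K.
  by rewrite -pochhammer_half_mul mulfK // expf_neq0.
(* Beyond this cutoff [2k > m], so the falling factorial vanishes. *)
rewrite (@hyp2F1_finite _ _ _ _ _ (m %/ 2).+1); last first.
  move=> k hk; rewrite pm ffact_small ?mul0r //.
  have := ltn_ceil m (ltn0Sn 1); lia.
rewrite horner_sum; apply: eq_bigr => k _.
rewrite hornerZ hornerXn pm pochhammer2 catalan_ballot /ballot mul1n !addn0.
(* The [4 ^+ k] from the argument [4 * t] cancels the denominator in [pm], and [m ^_ (2k)] becomes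
   ['C(m, 2k)] times [(2k)!]. *)
rewrite -bin_ffact exprMn.
have := expf_neq0 k four0; have := fact_neq0 K k; have := fact_neq0 K k.+1.
move: k`! k.+1`! (2 * k)`! 'C(m, 2 * k) (4 ^+ k) => a b c d e b0 a0 e0.
by rewrite !natrM; field; rewrite a0 b0 e0.
Qed.
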